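(* Let $M$ be a real symmetric $n\times n$ matrix with induced signed graph $\Gamma=(G,\sigma)$, $G=(V,E)$. Let $\lambda_k$ be the $k$-th eigenvalue of $M$, of multiplicity $r$, with $$\lambda_1\le\cdots\le\lambda_{k-1}<\lambda_k=\cdots=\lambda_{k+r-1}<\lambda_{k+r}\le\cdots\le\lambda_n$$ (strict inequalities vacuous when indices are out of range), and let $f_k$ be an eigenfunction for $\lambda_k$. Then $$\mathfrak{S}(f_k)\ge k+r-1-\ell'+\ell_+-|\mathcal F|,$$ where $\mathcal F=\mathcal F(G,f_k)$ is the Fiedler zero set, $\ell_+=\ell_+(G,\sigma,f_k)$, and $\ell'=\ell(G')$ with $G'$ the induced subgraph of $G$ on $\{x\in V: f_k(x)\ne0\}$.
   Context: The induced signed graph of a real symmetric $n\times n$ matrix $M$ has vertices $x_1,\dots,x_n$, edge $\{x_i,x_j\}$ iff $i\ne j$ and $M_{ij}\ne0$, sign $\sigma_{x_ix_j}=-M_{ij}/|M_{ij}|$. Eigenfunctions are nonzero eigenvectors viewed as functions on $V$. For a graph $H$, $\ell(H)=|E(H)|-|V(H)|+c(H)$, where $c(H)$ is the number of connected components. For $f:V\to\mathbb R$, let $H$ be the graph with vertex set $V$ and edge set $\{\{x,y\}\in E: f(x)\sigma_{xy}f(y)>0\}$, and set $\ell_+(G,\sigma,f)=|E(H)|-|V|+c(H)$. A vertex $x$ of degree $d_x$ is tree-like if removing $x$ and its incident edges from $G$ increases the number of connected components by $d_x-1$. The Fiedler zero set is $\mathcal F(G,f)=\{x\in V: f(x)=0,\text{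 and either } f(y)=0 \text{ for all } y\sim x, \text{ or } x \text{ is not tree-like}\}$. A walk is $y_1,\dots,y_m$ ($m\ge2$) with consecutive vertices adjacent; an S-walk of $f$ is a walk with $f(y_j)\sigma_{y_jy_{j+1}}f(y_{j+1})>0$ for all $j$. $\mathfrak{S}(f)$ is the number of equivalence classes (strong nodal domains) of the relation on $\{x:f(x)\ne0\}$ ''$x=y$ or an S-walk connects $x$ and $y$''. *)

(* Defs.v *)
From HB Require Import structures.
From mathcomp Require Import all_boot all_order all_algebra.
From mathcomp Require Import reals.
Set Implicit Arguments. Unset Strict Implicit. Unset Printing Implicit Defensive.
Import Order.TTheory GRing.Theory Num.Theory.
Local Open Scope ring_scope.

Section SignedGraph.
Variables (R : realType) (n : nat).
Implicit Types (M : 'M[R]_n) (f : 'I_n -> R) (A : {set 'I_n}) (e : rel 'I_n).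

Definition adj M : rel 'I_n := fun i j => (i != j) && (M i j != 0).

Definition sgn_edge M (i j : 'I_n) : R := - (M i j / `|M i j|).

Definition restrict A e : rel 'I_n := fun x y => [&& x \in A, y \in A & e x y].

Definition ncomp A e : nat :=
  #|[set [set y in A | connect (restrict A e) x y] | x in A]|.

Definition nedges A e : nat :=
  #|[set p : 'I_n * 'I_n | [&& (p.1 < p.2)%N, p.1 \in A, p.2 \in A & e p.1 p.2]]|.

Definition cyclo A e : int := (nedges A e)%:Z - (#|A|)%:Z + (ncomp A e)%:Z.

Definition pos_edge M f : rel 'I_n :=
  fun x y => adj M x y && (0 < f x * sgn_edge M x y * f y).

Definition ell_plus M f : int := cyclo setT (pos_edge M f).

Definition support f : {set 'I_n} := [set x | f x != 0].

Definition ell' M f : int := cyclo (support f) (adj M).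

Definition degree M (x : 'I_n) : nat := #|[set y | adj M x y]|.

Definition tree_like M (x : 'I_n) : bool :=
  (ncomp (setT :\ x) (adj M))%:Z == (ncomp setT (adj M))%:Z + (degree M x)%:Z - 1.

Definition fiedler_zero_set M f : {set 'I_n} :=
  [set x | (f x == 0) &&
           ([forall y, adj M x y ==> (f y == 0)] || ~~ tree_like M x)].

(* S-walk step relation; "x = y or an S-walk connects x and y" is
   connect (pos_edge M f), restricted to the support (automatic). *)
Definition strong_nodal_domains M f : nat := ncomp (support f) (pos_edge M f).

End SignedGraph.

(* 1-indexed access to the sorted eigenvalue list: lam s i = lambda_i *)
Definition lam (R : realType) (s : seq R) (i : nat) : R := nth 0 s i.-1.

(* Main.v *)
Require Import Defs.
From HB Require Import structures.
From mathcomp Require Import all_boot all_order all_algebra.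
From mathcomp Require Import reals ring lra zify.
Import Order.TTheory GRing.Theory Num.Theory.
Local Open Scope ring_scope.

(** Write [A = M - lambda_k] and call an edge negative if [f(x) sigma_xy f(y) < 0].
    Isolated zeros cancel in [S(f) - l_+], so the claim says that
    [k + r - 1 <= #negative edges + c(G') + |F|].  The left side is at most the
    rank of a subspace [W] on which the form of [A] is nonpositive (spectral
    theorem).  Restricting [W] to vectors vanishing on [F] costs at most [|F|].
    The remaining zeros [t] are tree-like with a neighbour [y] such that
    [f(y) <> 0]: the restriction [g] of [f] to the component of [y] in [G - t]
    is isotropic and [A g] is a nonzero multiple of [e_t] there, so [t] can be
    removed at no cost by trading a vector of [W] nonzero at [t] for [g].  On the
    support of [f], with [x = f y], the form is
    [- 1/2 sum_ij A_ij f_i f_j (y_i - y_j)^2]; imposing [y_i = y_j] on negative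
    edges and orthogonality to [f] on each component of [G'] leaves only [0]. *)

(** * Quadratic forms and the spectral theorem for symmetric matrices *)

Definition qform {R : pzRingType} {n} (A : 'M[R]_n) (x : 'rV[R]_n) : R :=
  (x *m A *m x^T) 0 0.

Definition negsemidef {R : numFieldType} {n} (A W : 'M[R]_n) : Prop :=
  forall x : 'rV[R]_n, (x <= W)%MS -> qform A x <= 0.

Lemma mulmx_tr_eq0 {R : realDomainType} {m n} (A : 'M[R]_(m, n)) : A *m A^T = 0 -> A = 0.
Proof.
move=> /matrixP AA0; apply/matrixP=> i j; move: (AA0 i i); rewrite !mxE.
under eq_bigr do rewrite mxE -expr2.
move=> /eqP; rewrite psumr_eq0 => [/allP/(_ j (mem_index_enum _))|k _]; last exact: sqr_ge0.
by rewrite sqrf_eq0 => /eqP.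
Qed.

Lemma mulmx_tr_ge0 {R : realDomainType} {n} (x : 'rV[R]_n) : 0 <= (x *m x^T) 0 0.
Proof. by rewrite mxE; apply: sumr_ge0 => i _; rewrite mxE -expr2 sqr_ge0. Qed.

Lemma trmxX {R : comNzRingType} {n} (A : 'M[R]_n.+1) j : (A ^+ j)^T = A^T ^+ j.
Proof. by elim: j => [|j IH]; rewrite ?trmx1 // exprSr exprS -mulmxE trmx_mul IH. Qed.

Lemma trmx_horner_mx {R : comNzRingType} {n} (A : 'M[R]_n.+1) p :
  (horner_mx A p)^T = horner_mx A^T p.
Proof.
elim/poly_ind: p => [|p c IH]; first by rewrite !rmorph0 trmx0.
rewrite !rmorphD !rmorphM /= !horner_mx_X !horner_mx_C linearD /= tr_scalar_mx.
by rewrite -mulmxE trmx_mul IH comm_mx_horner.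
Qed.

(** For symmetric [A], the product of [A ^+ j.+1] with its transpose is a power of [A] at least as
    high as [j.+2], which lowers the exponent one step at a time. *)
Lemma sym_nilpotent_eq0 {R : realDomainType} {n} (A : 'M[R]_n.+1) j :
  A^T = A -> A ^+ j.+1 = 0 -> A = 0.
Proof.
move=> sA; elim: j => [|j IH] Aj0; first by rewrite -(expr1 A).
apply: IH; apply: mulmx_tr_eq0; rewrite trmxX sA mulmxE -exprD.
by rewrite addSnnS exprD Aj0 mulr0.
Qed.

(** The product [p] of the distinct factors of the characteristic polynomial takes a symmetric
    nilpotent value at [A], hence the value [0]; the minimal polynomial then splits with simple
    roots. The matrix [P] need not be orthogonal. *)
Lemma sym_diagonalizable {R : realFieldType} {n} (A : 'M[R]_n.+1) (s : seq R) : A^T = A ->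
  char_poly A = \prod_(x <- s) ('X - x%:P) ->
  exists2 P, P \in unitmx & exists d, P *m A = diag_mx d *m P.
Proof.
move=> sA chA; have [_] := diagonalizableP A.
case; last first.
  move=> P Pu /diagonalizable_forPex[d /(simmxP Pu) PA]; exists P => //.
  by exists d.
exists (undup s); rewrite ?undup_uniq //.
apply: mxminpoly_min; set p := \prod_(x <- _) _.
apply: (@sym_nilpotent_eq0 _ _ _ (size s)).
  by rewrite trmx_horner_mx sA.
rewrite -rmorphXn /=; apply/mxminpoly_minP.
apply: dvdp_trans (mxminpoly_dvd_char _) _; rewrite chA.
have root_p x : x \in s -> root p x by rewrite root_prod_XsubC mem_undup.
elim: (s) root_p => [|x t IH] root_p /=; first by rewrite big_nil dvd1p.
rewrite big_cons exprS dvdp_mul // ?dvdp_XsubCl ?root_p ?mem_head //.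
by apply: IH => y yt; rewrite root_p // in_cons yt orbT.
Qed.

Lemma char_poly_similar {R : fieldType} {n} (P A B : 'M[R]_n) :
  P \in unitmx -> P *m A = B *m P -> char_poly A = char_poly B.
Proof.
move=> Pu PAB; pose P' := map_mx polyC P.
have detP' : \det P' != 0.
  by rewrite det_map_mx polyC_eq0 -unitfE -unitmxE.
apply: (mulfI detP'); rewrite -det_mulmx [RHS]mulrC -det_mulmx; congr (\det _).
by rewrite mulmxBr mulmxBl -!map_mxM PAB /= scalar_mxC.
Qed.

(** [W] is spanned by the rows of [P] with eigenvalue at most [l]. The Gram matrix of [P] need not
    be the identity, but it only pairs rows with equal eigenvalues, which is enough to make the form
    minus a sum of squares. *)
Lemma sym_negsemidef_rank {R : rcfType} {n} (M : 'M[R]_n) (s : seq R) (l : R) : M^T = M ->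
  char_poly M = \prod_(x <- s) ('X - x%:P) ->
  exists W : 'M[R]_n, (count (<= l) s <= \rank W)%N /\ negsemidef (M - l%:M) W.
Proof.
(* In size [0] the characteristic polynomial is [1], so [s] is empty. *)
case: n M => [|n] M sM chM.
  exists 0; split; last by move=> x; rewrite /qform [x]thinmx0 !mul0mx mxE.
  case: s chM => [//|x s].
  rewrite /char_poly det_mx00 => /(congr1 (fun p => size (polyseq p))).
  by rewrite size_poly1 size_prod_XsubC.
have [P Pu [d PM]] := sym_diagonalizable _ _ sM chM.
have perm_sd : perm_eq s [seq d 0 i | i <- enum 'I_n.+1].
  apply: prod_XsubC_eq; rewrite -chM (char_poly_similar _ _ _ Pu PM).
  rewrite char_poly_trig ?diag_mx_is_trig // big_map big_enum /=.
  by apply: eq_bigr => i _; rewrite mxE eqxx.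
pose D := diag_mx (\row_i ((d 0 i <= l)%R%:R : R)).
pose W := D *m P.
exists W; split.
  rewrite (seq.permP perm_sd) count_map -size_filter enumT.
  pose I := [pred i | d 0 i <= l].
  rewrite [filter _ _](_ : _ = enum I) -?cardE; last by rewrite /enum_mem.
  rewrite mxrankMfree ?row_free_unit //.
  (* [B] selects the unit vectors with index in [I]; these are fixed by [D], so [D] has rank at
     least [#|I|]. *)
  pose B : 'M[R]_(#|I|, n.+1) := rowsub enum_val 1%:M.
  have Bfree : row_free B.
    apply/row_freeP; exists B^T; apply/matrixP=> i j.
    rewrite /B mul_rowsub_mx mul1mx !mxE.
    by rewrite (inj_eq enum_val_inj) eq_sym.
  rewrite -{1}(eqP Bfree); suff <- : B *m D = B by exact: mxrankM_maxr.
  apply/matrixP=> i j; rewrite mul_mx_diag !mxE.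
  have [<-|_] := eqVneq; last by rewrite mul0r.
  by have := enum_valP i; rewrite inE => ->; rewrite mulr1.
move=> _ /submxP[c ->]; rewrite /qform.
pose S := P *m P^T; pose y := c *m D.
(* Both products equal the symmetric matrix [P *m M *m P^T], so [S] commutes with the diagonal
   matrix. *)
have SP i j : (d 0 i == d 0 j) || (S i j == 0).
  have /matrixP/(_ i j) : diag_mx d *m S = S *m diag_mx d.
    rewrite mulmxA -PM -mulmxA -{1}sM -trmx_mul PM trmx_mul tr_diag_mx.
    by rewrite !mulmxA.
  rewrite mul_diag_mx mul_mx_diag !mxE => /eqP.
  by rewrite mulrC -subr_eq0 -mulrBr mulf_eq0 subr_eq0 orbC.
(* Wherever [y] is nonzero the square root is genuine, and [S] links only equal eigenvalues, so the
   roots from the two sides multiply to [l - d 0 i]. *)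
pose z := \row_i (y 0 i * Num.sqrt (l - d 0 i)).
suff -> : (c *m W *m (M - l%:M) *m (c *m W)^T) = - ((z *m P) *m (z *m P)^T).
  by rewrite mxE oppr_le0 mulmx_tr_ge0.
transitivity (y *m (diag_mx d - l%:M) *m S *m y^T).
  have PMl : P *m (M - l%:M) = (diag_mx d - l%:M) *m P.
    by rewrite mulmxBr mulmxBl PM scalar_mxC.
  by rewrite /W mulmxA -/y trmx_mul -(mulmxA y) PMl !mulmxA.
have -> : z *m P *m (z *m P)^T = z *m S *m z^T by rewrite trmx_mul !mulmxA.
have yP i : (y 0 i == 0) || (d 0 i <= l).
  rewrite /y mul_mx_diag !mxE.
  by case: (d 0 i <= l); rewrite ?orbT // mulr0 eqxx.
clearbody S y.
have diagB : diag_mx d - l%:M = diag_mx (\row_i (d 0 i - l)).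
  by apply/matrixP=> i j; rewrite !mxE mulrnBl.
rewrite diagB mul_mx_diag; apply/matrixP=> a b; rewrite !ord1 !mxE -sumrN.
apply: eq_bigr => j _; rewrite -mulNr !mxE !mulr_suml -sumrN mulr_suml.
apply: eq_bigr => i _; rewrite !mxE.
case/orP: (SP i j) => [/eqP dij|/eqP ->]; last by rewrite !(mulr0, mul0r, oppr0).
case/orP: (yP i) => [/eqP ->|dil]; first by rewrite !(mulr0, mul0r, oppr0).
rewrite -dij.
have sq : Num.sqrt (l - d 0 i) * Num.sqrt (l - d 0 i) = l - d 0 i.
  by rewrite -expr2 sqr_sqrtr // subr_ge0.
rewrite -(opprB l); set e := Num.sqrt _ in sq *; rewrite -sq; ring.
Qed.

(** * Subspaces cut out by linear conditions *)

Lemma annihilated_subspace {F : fieldType} {n} (W : 'M[F]_n) (cs : seq 'cV[F]_n) :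
  exists2 W' : 'M_n, (W' <= W)%MS /\ {in cs, forall c, W' *m c = 0} &
    (\rank W <= \rank W' + size cs)%N.
Proof.
elim: cs => [|c cs [W1 [W1W W1cs] rk]]; first by exists W => //=; rewrite addn0.
exists (W1 :&: kermx c)%MS; first split.
- exact: submx_trans (capmxSl _ _) W1W.
- move=> d; rewrite inE => /predU1P[->|/W1cs W1d].
    by apply: sub_kermxP; exact: capmxSr.
  by have /submxP[D ->] := capmxSl W1 (kermx c); rewrite -mulmxA W1d mulmx0.
- have := mxrank_mul_ker W1 c; have := rank_leq_col (W1 *m c) => /=; lia.
Qed.

Lemma mul_delta_mx_cV {R : pzRingType} {m n} (A : 'M[R]_(m, n)) i j k :
  (A *m (delta_mx i 0 : 'cV_n)) j k = A j i.
Proof. by rewrite -colE mxE. Qed.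

Definition supported {F : fieldType} {n} (S : {set 'I_n}) (W : 'M[F]_n) : Prop :=
  forall x : 'rV[F]_n, (x <= W)%MS -> forall i, i \notin S -> x 0 i = 0.

Lemma restrict_support {F : fieldType} {n} (W : 'M[F]_n) (S T : {set 'I_n}) :
  supported S W ->
  exists W' : 'M_n, [/\ (W' <= W)%MS, supported (S :\: T) W' &
    (\rank W <= \rank W' + #|T|)%N].
Proof.
move=> WS; pose cs : seq 'cV[F]_n := [seq delta_mx i 0 | i in T].
have [W' [W'W W'cs]] := annihilated_subspace W cs; rewrite size_map -cardE => rk.
exists W'; split=> // x xW' i; rewrite inE negb_and negbK => /orP[iT|]; last first.
  by apply: WS; apply: submx_trans W'W.
have /submxP[c ->] := xW'; rewrite -(mul_delta_mx_cV _ _ _ 0) -mulmxA W'cs ?mulmx0 ?mxE //.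
by apply/imageP; exists i.
Qed.

(** * Trading one coordinate for an isotropic vector *)

Section QuadraticForm.
Variables (R : realFieldType) (n : nat) (A : 'M[R]_n).
Hypothesis symA : A^T = A.

Lemma qformDZ (x g : 'rV[R]_n) a :
  qform A (x + a *: g) = qform A x + 2 * a * (g *m A *m x^T) 0 0 + a ^+ 2 * qform A g.
Proof.
have xg : (x *m A *m g^T) 0 0 = (g *m A *m x^T) 0 0.
  have -> : g *m A *m x^T = (x *m A *m g^T)^T by rewrite !trmx_mul trmxK symA mulmxA.
  by rewrite [RHS]mxE.
rewrite /qform !mulmxDl linearD /= !mulmxDr linearZ /= -!scalemxAl -!scalemxAr.
set p := x *m A *m g^T in xg *; set q := g *m A *m x^T in xg *.
set u := x *m A *m x^T; set v := g *m A *m g^T.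
clearbody p q u v; rewrite !mxE xg; ring.
Qed.

(* The form is zero at [g], and [g] pairs on [S] with the coordinate [t] only:
   [g] can take the place of a vector of [W] that is nonzero at [t]. *)
Lemma negsemidef_drop_vertex (W : 'M[R]_n) (S : {set 'I_n}) t (g : 'rV[R]_n) :
    supported S W -> negsemidef A W -> t \in S ->
    (forall i, i \notin S :\ t -> g 0 i = 0) ->
    (forall i, i \in S :\ t -> (g *m A) 0 i = 0) ->
    (g *m A) 0 t != 0 ->
  exists W' : 'M[R]_n, [/\ supported (S :\ t) W', negsemidef A W' &
    (\rank W <= \rank W')%N].
Proof.
move=> WS Wneg tS gS gA gAt.
have gAx (x : 'rV_n) : (forall i, i \notin S -> x 0 i = 0) ->
    (g *m A *m x^T) 0 0 = (g *m A) 0 t * x 0 t.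
  move=> xS; rewrite mxE (bigD1 t) //= big1 ?addr0 ?mxE // => i it.
  rewrite [_^T _ _]mxE; have [iS|/xS ->] := boolP (i \in S); last by rewrite mulr0.
  by rewrite gA ?mul0r // !inE it.
have gt0 : g 0 t = 0 by rewrite gS // !inE eqxx.
have gg : qform A g = 0.
  rewrite /qform gAx ?gt0 ?mulr0 // => i iS; apply: gS.
  by rewrite inE (negPf iS) andbF.
have [W0 [W0W W0S rk]] := restrict_support W S [set t] WS; rewrite cards1 in rk.
(* If all of [W] already vanishes at [t], nothing has to be traded. *)
have [Wt0|] := boolP [forall i, W i t == 0].
  exists W; split=> // x xW i; rewrite in_setD1 negb_and negbK => /orP[/eqP->|]; last exact: WS.
  have /submxP[c ->] := xW; rewrite mxE big1 // => j _.
  by rewrite (eqP (forallP Wt0 j)) mulr0.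
rewrite negb_forall => /existsP[j Wjt].
have gW0 : ~~ (g <= W0)%MS.
  apply/negP => gW0; have gW := submx_trans gW0 W0W.
  pose w := row j W; pose c := (g *m A) 0 t * W j t.
  have wW : (w <= W)%MS by exact: row_sub.
  have c0 : c != 0 by rewrite mulf_neq0.
  (* Along [w + a *: g] the form is affine in [a] with slope [2 * c]; this [a] makes its value [1],
     which is impossible inside [W]. *)
  pose a := (1 - qform A w) / (2 * c).
  have : qform A (w + a *: g) <= 0.
    by apply: Wneg; rewrite addmx_sub // scalemx_sub.
  rewrite qformDZ gg gAx; last exact: WS.
  rewrite mulr0 addr0 [w 0 t]mxE -/c.
  have -> : 2 * a * c = 1 - qform A w by rewrite /a; field.
  by rewrite addrC subrK ler10.
(* Vanishing at [t] costs [W0] at most one dimension, and [g] restores it. Vectors of [W0] are zero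
   at [t], so they do not pair with [g]. *)
exists (W0 + g)%MS; split.
- move=> _ /sub_addsmxP[[u v] /= ->] i iS.
  rewrite mxE W0S ?submxMl // add0r mxE big1 // => k _.
  by rewrite ord1 gS ?mulr0.
- move=> _ /sub_addsmxP[[u v] /= ->].
  rewrite [v]mx11_scalar mul_scalar_mx qformDZ gg mulr0 addr0.
  have uW : (u *m W0 <= W)%MS := submx_trans (submxMl _ _) W0W.
  rewrite gAx; last exact: WS.
  by rewrite (W0S (u *m W0)) ?submxMl ?inE ?eqxx // !mulr0 addr0 Wneg.
- apply: leq_trans rk _; rewrite addn1.
  rewrite ltn_neqAle (mxrank_leqif_sup (addsmxSl W0 g)) addsmx_sub submx_refl (negPf gW0) /=.
  exact: mxrankS (addsmxSl _ _).
Qed.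
End QuadraticForm.

(** * Components of a graph after deletion of a vertex *)

Section Components.
Context {n : nat}.
Implicit Types (e : rel 'I_n) (S T : {set 'I_n}).

(** The set under the image in [ncomp], so that [ncomp S e] is [#|component S e @: S|] by
    conversion. *)
Definition component S e (x : 'I_n) : {set 'I_n} := [set y in S | connect (restrict S e) x y].

Lemma restrict_sym {S e} : symmetric e -> symmetric (restrict S e).
Proof. by move=> se x y; rewrite /restrict se andbCA. Qed.

Lemma component_eq {S e x y} : symmetric e ->
  connect (restrict S e) x y -> component S e x = component S e y.
Proof.
move=> se xy; apply/setP=> z; rewrite !inE.
by rewrite (same_connect (sym_connect_sym (restrict_sym se)) xy).
Qed.

Lemma restrictS {S T e} : S \subset T -> subrel (restrict S e) (restrict T e).
Proof. by move=> ST x y /and3P[xS yS xy]; rewrite /restrict !(subsetP ST). Qed.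

Lemma connect_restrictS {S T e x y} : S \subset T ->
  connect (restrict S e) x y -> connect (restrict T e) x y.
Proof. by move=> ST; apply: connect_sub => u v uv; apply/connect1/(restrictS ST). Qed.

Lemma component_delete_vertex e t x : symmetric e ->
  ~~ connect (restrict setT e) x t -> component (setT :\ t) e x = component setT e x.
Proof.
move=> se xt; apply/setP => y; rewrite !inE andbT /=.
apply/andP/idP => [[_]|xy]; first by apply: connect_restrictS; exact: subsetT.
split; first by apply: contraNneq xt => <-.
have /connectP[p pth ->] := xy; apply/connectP; exists p => //.
have /allP px : {in x :: p, forall z, z != t}.
  by move=> z zp; apply: contraNneq xt => <-; exact: path_connect zp.
apply: sub_in_path px pth => u v /= ut vt.
by rewrite /restrict !inE /= -!topredE /= in ut vt *; rewrite ut vt.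
Qed.

(** A path without repetition from [t] to [x] never returns to [t]; its second vertex is the
    required [y]. *)
Lemma neighbor_in_component e t x : symmetric e -> x != t ->
  connect (restrict setT e) x t ->
  exists2 y, e t y & connect (restrict (setT :\ t) e) x y.
Proof.
move=> se xt; rewrite (sym_connect_sym (restrict_sym se)) => /connectP[p0 /shortenP[p pth up _]].
case: p pth up => [|y p] /=; first by move=> _ _ tx; rewrite tx eqxx in xt.
case/andP=> /and3P[_ _ ty] pth /andP[tp _] xE; exists y => //.
rewrite (sym_connect_sym (restrict_sym se)); apply/connectP; exists p => //.
have /allP py : {in y :: p, forall z, z != t}.
  by move=> z zp; apply: contraNneq tp => <-.
apply: sub_in_path py pth => u v /= ut vt.
by rewrite /restrict !inE /= -!topredE /= in ut vt *; rewrite ut vt.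
Qed.

(** A component left after deleting [t] either was a component before or contains a neighbour of
    [t]. The successor accounts for the old component of [t], which disappears. *)
Lemma ncomp_delete_vertex e t : symmetric e ->
  ((ncomp (setT :\ t) e).+1 <=
     ncomp setT e + #|component (setT :\ t) e @: [set y | e t y]|)%N.
Proof.
move=> se; pose K := component setT e @: setT.
have -> : ncomp setT e = #|K| by [].
rewrite (cardsD1 (component setT e t)) imset_f ?inE // add1n addSn ltnS.
apply: leq_trans (leq_card_setU _ _); apply: subset_leq_card.
apply/subsetP=> _ /imsetP[x + ->]; rewrite in_setD1 => /andP[xt _]; rewrite inE.
have [xct|xct] := boolP (connect (restrict setT e) x t).
  have [y ty xy] := neighbor_in_component _ _ _ se xt xct.
  apply/orP; right; apply/imsetP; exists y; rewrite ?inE //.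
  exact: component_eq.
apply/orP; left; rewrite inE -/(component _ _ _) component_delete_vertex // imset_f ?inE // andbT.
apply: contra xct => /eqP/setP/(_ t); rewrite !inE connect0 andbT /= => ->.
by [].
Qed.
End Components.

(** * Tree-like vertices *)

Section MatrixGraph.
Context {R : realType} {n : nat} (M : 'M[R]_n).
Hypothesis symM : M^T = M.

Lemma sym_coef i j : M i j = M j i.
Proof. by rewrite -{1}symM mxE. Qed.

Lemma adj_sym : symmetric (adj M).
Proof. by move=> i j; rewrite /adj eq_sym sym_coef. Qed.

(** Being tree-like is the equality case of [ncomp_delete_vertex] with as many components as
    neighbours: distinct neighbours of [t] fall into distinct components. *)
Lemma tree_like_connect_inj t x y : tree_like M t -> adj M t x -> adj M t y ->
  connect (restrict (setT :\ t) (adj M)) x y -> x = y.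
Proof.
move=> tl tx ty xy.
have := ncomp_delete_vertex (adj M) t adj_sym.
set N := [set y | adj M t y]; set C := component _ _.
have := leq_imset_card C N => le1 le2.
have /imset_injP injC : #|C @: N| == #|N|.
  have tlE : (ncomp (setT :\ t) (adj M)).+1 = (ncomp setT (adj M) + #|N|)%N.
    by move: (eqP tl); rewrite /degree -/N; clear; lia.
  by rewrite eqn_leq le1; rewrite tlE leq_add2l in le2.
by apply: injC; rewrite ?inE //; exact: component_eq adj_sym xy.
Qed.
End MatrixGraph.

(** * Negative edges and the rank of a nonpositive subspace *)

Section Nodal.
Context {R : realType} {n : nat} (M : 'M[R]_n) (l : R) (f : 'cV[R]_n).
Hypotheses (symM : M^T = M) (eigf : M *m f = l *: f).

Local Notation fk := (fun x : 'I_n => f x 0).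
Local Notation A := (M - l%:M).
Local Notation V := (Defs.support fk).

(** On the support the product over an edge is nonzero, so an edge that is not positive is negative.
    The order on the pair counts each edge once. *)
Definition neg_edges : {set 'I_n * 'I_n} :=
  [set p : 'I_n * 'I_n | [&& (p.1 < p.2)%N, p.1 \in V, p.2 \in V, adj M p.1 p.2 &
              ~~ pos_edge M fk p.1 p.2]].

Lemma shift_sym : A^T = A.
Proof. by rewrite linearB /= tr_scalar_mx symM. Qed.

Lemma shift_coef i j : i != j -> A i j = M i j.
Proof. by move=> /negPf ij; rewrite !mxE ij mulr0n subr0. Qed.

Lemma shift_kernel : A *m f = 0.
Proof. by rewrite mulmxBl eigf mul_scalar_mx subrr. Qed.

Lemma pos_edge_coef i j : pos_edge M fk i j = adj M i j && (M i j * f i 0 * f j 0 < 0).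
Proof.
rewrite /pos_edge /sgn_edge; have [/andP[_ Mij]|//] := boolP (adj M i j) => /=.
rewrite mulrN mulNr oppr_gt0.
have -> : f i 0 * (M i j / `|M i j|) * f j 0 = `|M i j|^-1 * (M i j * f i 0 * f j 0) by ring.
by rewrite pmulr_rlt0 // invr_gt0 normr_gt0.
Qed.

Lemma pos_edge_sym : symmetric (pos_edge M fk).
Proof.
by move=> i j; rewrite !pos_edge_coef (adj_sym _ symM) (sym_coef _ symM) mulrAC.
Qed.

(** Expanding the square, the terms in [y i ^+ 2] and [y j ^+ 2] sum to zero because [A *m f = 0];
    only the cross terms survive. *)
Lemma qform_ratio (y : 'I_n -> R) :
  \sum_i \sum_j A i j * f i 0 * f j 0 * (y i - y j) ^+ 2 =
  - 2 * qform A (\row_i (f i 0 * y i)).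
Proof.
have sA i j : A i j = A j i by rewrite -[in LHS]shift_sym mxE.
have ker i : \sum_j A i j * f j 0 = 0.
  by have /matrixP/(_ i 0) := shift_kernel; rewrite mxE [RHS]mxE.
have term i j : A i j * f i 0 * f j 0 * (y i - y j) ^+ 2 =
    f i 0 * y i ^+ 2 * (A i j * f j 0) + f j 0 * y j ^+ 2 * (A j i * f i 0)
    - 2 * (f i 0 * y i * A i j * (f j 0 * y j)).
  rewrite (sA j i); ring.
under eq_bigr do under eq_bigr do rewrite term.
under eq_bigr do rewrite big_split /= big_split /= -mulr_sumr ker mulr0 add0r.
rewrite big_split /= exchange_big /= [X in X + _]big1 ?add0r; last first.
  by move=> i _; rewrite -mulr_sumr ker mulr0.
rewrite /qform mxE exchange_big mulr_sumr; apply: eq_bigr => j _.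
rewrite [(_ *m A) 0 j]mxE [_^T j 0]mxE [_ 0 j]mxE mulr_suml mulr_sumr.
by apply: eq_bigr => i _; rewrite [_ 0 i]mxE mulNr.
Qed.

Lemma negsemidef_ratio_const (y : 'I_n -> R) :
  qform A (\row_i (f i 0 * y i)) <= 0 ->
  {in neg_edges, forall p, y p.1 = y p.2} ->
  forall i j, restrict V (adj M) i j -> y i = y j.
Proof.
move=> q0 yneg.
(* Each [u p] is nonnegative: positive edges have a negative coefficient, and across negative edges
   [y] does not change. Their sum is twice the form, hence at most [0], so every [u p] vanishes. *)
pose u (p : 'I_n * 'I_n) := - (A p.1 p.2 * f p.1 0 * f p.2 0 * (y p.1 - y p.2) ^+ 2).
have yadj i j : restrict V (adj M) i j -> ~~ pos_edge M fk i j -> y i = y j.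
  case/and3P=> iV jV ij nij; have [lij|lji|eij] := ltngtP i j.
  - by apply: (yneg (i, j)); rewrite inE /= lij iV jV ij.
  - symmetry; apply: (yneg (j, i)); rewrite inE /= lji iV jV.
    by rewrite (adj_sym _ symM) ij pos_edge_sym.
  - by rewrite (val_inj eij).
have u_ge0 p : 0 <= u p.
  case: p => i j; rewrite /u /= oppr_ge0.
  have [->|ij] := eqVneq i j; first by rewrite subrr expr0n mulr0.
  rewrite shift_coef //.
  have [pij|nij] := boolP (pos_edge M fk i j).
    move: pij; rewrite pos_edge_coef => /andP[_ neg].
    by rewrite nmulr_rle0 // sqr_ge0.
  have [Mij|Mij] := eqVneq (M i j) 0; first by rewrite Mij !mul0r.
  have [fi|fi] := eqVneq (f i 0) 0; first by rewrite fi mulr0 !mul0r.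
  have [fj|fj] := eqVneq (f j 0) 0; first by rewrite fj mulr0 !mul0r.
  rewrite (yadj i j) ?subrr ?expr0n ?mulr0 //.
  by rewrite /restrict /adj !inE fi fj ij Mij.
have sum_u : \sum_p u p <= 0.
  have := qform_ratio y; rewrite pair_big /= => sumE.
  rewrite sumrN sumE; lra.
have u0 p : u p = 0.
  apply/eqP; move: sum_u; rewrite le_eqVlt ltNge sumr_ge0 // orbF psumr_eq0 //.
  by move/allP/(_ p (mem_index_enum _)).
move=> i j rij; have := u0 (i, j); rewrite /u /= => /eqP.
case/and3P: rij; rewrite !inE => fi fj /andP[ij Mij].
rewrite shift_coef // oppr_eq0 !mulf_eq0 (negPf fi) (negPf fj) (negPf Mij) /=.
by rewrite orbb subr_eq0 => /eqP.
Qed.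

Lemma rank_negsemidef_support (W : 'M[R]_n) : supported V W -> negsemidef A W ->
  (\rank W <= #|neg_edges| + ncomp V (adj M))%N.
Proof.
move=> WV Wneg; rewrite leqNgt; apply/negP => big_rank.
pose K := component V (adj M) @: V.
(* [cs1] makes the ratio of [x] to [f] agree across each negative edge; [cs2] makes [x] orthogonal
   to [f] on each component of the support. *)
pose cs1 : seq 'cV[R]_n :=
  [seq (f p.1 0)^-1 *: delta_mx p.1 0 - (f p.2 0)^-1 *: delta_mx p.2 0 | p in neg_edges].
pose cs2 : seq 'cV[R]_n := [seq \col_v ((v \in C)%:R * f v 0) | C : {set 'I_n} in K].
have [W' [W'W W'cs]] := annihilated_subspace W (cs1 ++ cs2).
rewrite size_cat !size_map -!cardE => rk.
have {}rk : (0 < \rank W')%N.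
  by rewrite lt0n; apply: contraTneq rk => ->; rewrite add0n -ltnNge.
have [i W'i] : exists i, row i W' != 0.
  apply/existsP; rewrite -negb_forall; apply: contraL rk => /forallP W'0.
  by rewrite lt0n negbK mxrank_eq0; apply/eqP/row_matrixP=> i; rewrite row0; apply/eqP.
pose x := row i W'.
have xW : (x <= W)%MS by apply: submx_trans (row_sub _ _) W'W.
have xcs c : c \in cs1 ++ cs2 -> x *m c = 0.
  by move=> cc; rewrite /x -row_mul W'cs // row0.
have x0 : x != 0 by [].
(* Where [f] vanishes the inverse is [0] by convention; there [x] vanishes too, so [xE] holds
   everywhere. *)
clearbody x; pose y j := (f j 0)^-1 * x 0 j.
have xE : x = \row_j (f j 0 * y j).
  apply/rowP=> j; rewrite [RHS]mxE /y mulrA; have [fj|fj] := eqVneq (f j 0) 0.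
    by rewrite fj mul0r mul0r (WV _ xW) // inE fj eqxx.
  by rewrite mulfV // mul1r.
have yadj : forall i j, restrict V (adj M) i j -> y i = y j.
  apply: negsemidef_ratio_const; first by rewrite -xE; exact: Wneg.
  move=> p pE; apply/eqP; rewrite -subr_eq0; apply/eqP.
  have : x *m ((f p.1 0)^-1 *: delta_mx p.1 0 - (f p.2 0)^-1 *: delta_mx p.2 0) = 0 :> 'M_1.
    by apply: xcs; rewrite mem_cat; apply/orP; left; apply/imageP; exists p.
  have dE j : x *m delta_mx j 0 = (x 0 j)%:M :> 'M_1.
    by apply/matrixP=> a b; rewrite mul_delta_mx_cV !ord1 [RHS]mxE.
  by move/matrixP/(_ 0 0); rewrite mulmxBr -!scalemxAr !dE !mxE eqxx !mulr1n.
have yconn i0 j0 : connect (restrict V (adj M)) i0 j0 -> y i0 = y j0.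
  case/connectP=> p; elim: p i0 => [|k p IH] i0 /=; first by move=> _ ->.
  by case/andP=> /yadj -> pth /IH -> //.
case/negP: x0; apply/eqP/rowP=> v; rewrite [RHS]mxE.
have [vV|vV] := boolP (v \in V); last exact: (WV _ xW).
pose C := component V (adj M) v.
have vC : v \in C by rewrite inE vV connect0.
have : x *m (\col_v ((v \in C)%:R * f v 0)) = 0 :> 'M_1.
  apply: xcs; rewrite mem_cat; apply/orP; right; apply/imageP; exists C => //.
  exact: imset_f.
move/matrixP/(_ 0 0); rewrite mxE [RHS]mxE.
have -> : \sum_j x 0 j * (\col_w ((w \in C)%:R * f w 0)) j 0 = y v * \sum_(j in C) f j 0 ^+ 2.
  rewrite mulr_sumr [RHS]big_mkcond; apply: eq_bigr => j _; rewrite xE !mxE.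
  have [|_] := boolP (j \in C); last by rewrite mul0r mulr0.
  rewrite inE => /andP[_ /yconn ->]. rewrite mul1r; ring.
move/eqP; rewrite mulf_eq0 => /orP[/eqP yv|]; first by rewrite xE mxE yv mulr0.
rewrite psumr_eq0 => [/allP/(_ v (mem_index_enum _))|j _]; last exact: sqr_ge0.
by rewrite vC sqrf_eq0; move: vV; rewrite inE => /negPf ->.
Qed.

(** The isotropic vector is [f] cut down to the component [C] of [z], a neighbour of [t] with
    nonzero value. Inside [C] the eigenvalue equation is unaffected, since no edge leads from [C] to
    the rest of [S :\ t]. *)
Lemma negsemidef_drop_tree_like (W : 'M[R]_n) (S : {set 'I_n}) t : V \subset S -> t \in S ->
  f t 0 = 0 -> t \notin fiedler_zero_set M fk ->
  supported S W -> negsemidef A W ->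
  exists W' : 'M[R]_n, [/\ supported (S :\ t) W', negsemidef A W' &
    (\rank W <= \rank W')%N].
Proof.
move=> VS tS ft; rewrite inE ft eqxx /= negb_or negbK => /andP[+ tl] WS Wneg.
rewrite negb_forall => /existsP[z]; rewrite negb_imply => /andP[tz fz].
have zt : z != t by case/andP: tz; rewrite eq_sym.
have VSt : V \subset S :\ t.
  apply/subsetP=> i iV; rewrite in_setD1 (subsetP VS) // andbT.
  by apply: contraTneq iV => ->; rewrite inE ft eqxx.
pose C := component (S :\ t) (adj M) z.
have CS i : i \in C -> i \in S :\ t by rewrite inE => /andP[].
have zC : z \in C.
  by rewrite inE connect0 andbT; apply: (subsetP VSt); rewrite inE.
pose g : 'rV[R]_n := \row_i ((i \in C)%:R * f i 0).
have sA i j : A i j = A j i by rewrite -[in LHS]shift_sym mxE.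
have gAE i : (g *m A) 0 i = \sum_(j in C) f j 0 * A j i.
  rewrite mxE [RHS]big_mkcond; apply: eq_bigr => j _; rewrite [g 0 j]mxE.
  by case: (j \in C); rewrite ?mul1r // !mul0r.
have CA i j : i \in C -> j \in S :\ t -> j \notin C -> A i j = 0.
  move=> iC jS; apply: contraNeq => Aij.
  have [<-//|ij] := eqVneq i j; rewrite inE jS /=.
  move: (iC); rewrite inE => /andP[iS] zi; apply: connect_trans zi (connect1 _).
  by rewrite /restrict iS jS /adj ij -shift_coef.
apply: (@negsemidef_drop_vertex _ _ _ shift_sym W S t g) => //.
- move=> i iS; rewrite mxE (_ : i \in C = false) ?mul0r //.
  by apply: contraNF iS; exact: CS.
- move=> i iS; rewrite gAE; have [iC|iC] := boolP (i \in C); last first.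
    by rewrite big1 // => j jC; rewrite CA ?mulr0.
  have /matrixP/(_ i 0) := shift_kernel; rewrite mxE [RHS]mxE => fi0; rewrite -[RHS]fi0.
  rewrite [LHS]big_mkcond; apply: eq_bigr => j _.
  case: ifPn => jC; first by rewrite mulrC sA.
  have [->|fj] := eqVneq (f j 0) 0; first by rewrite mulr0.
  by rewrite CA ?mul0r //; apply: (subsetP VSt); rewrite inE.
(* Another neighbour of [t] in [C] would be joined to [z] in the whole graph without [t], against
   tree-likeness; so [z] alone contributes at [t]. *)
- rewrite gAE (bigD1 z) //= big1 ?addr0 => [|j /andP[jC jz]].
    rewrite mulf_neq0 // shift_coef // (sym_coef _ symM).
    by case/andP: tz.
  apply/eqP; apply: contraNT jz; rewrite mulf_eq0 negb_or => /andP[_ Ajt].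
  have jt : j != t by move: (CS _ jC); rewrite in_setD1 => /andP[].
  apply/eqP/esym; apply: (tree_like_connect_inj _ symM t) => //.
    by rewrite (adj_sym _ symM) /adj jt -shift_coef.
  move: jC; rewrite inE => /andP[_]; apply: connect_restrictS.
  by apply: setSD; exact: subsetT.
Qed.

Lemma rank_negsemidef_tree_like (W : 'M[R]_n) (S : {set 'I_n}) :
  V \subset S -> [disjoint S & fiedler_zero_set M fk] ->
  supported S W -> negsemidef A W ->
  (\rank W <= #|neg_edges| + ncomp V (adj M))%N.
Proof.
(* Induction on a bound for [#|S|]: zeros in [S] are removed one by one until [S] is the support.
   The Fiedler set always refers to the full graph. *)
elim: {S}_.+1 {-2}S (ltnSn #|S|) W => // m IH S Sm W VS SF WS Wneg.
have [SV|] := boolP (S \subset V).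
  apply: rank_negsemidef_support => // x xW i iV.
  by apply: WS => //; apply: contra iV; apply: subsetP.
case/subsetPn => t tS tV.
have ft : f t 0 = 0 by apply/eqP; move: tV; rewrite inE negbK.
have [W' [W'S W'neg rk]] :=
  negsemidef_drop_tree_like _ _ _ VS tS ft (negbT (disjointFr SF tS)) WS Wneg.
apply: leq_trans rk _; apply: IH W'S W'neg.
- by move: Sm; rewrite (cardsD1 t) tS.
- by rewrite subsetD1 VS.
- by apply: disjointWl SF; exact: subD1set.
Qed.

Lemma rank_negsemidef (W : 'M[R]_n) : negsemidef A W ->
  (\rank W <= #|neg_edges| + ncomp V (adj M) + #|fiedler_zero_set M fk|)%N.
Proof.
move=> Wneg.
have WT : supported setT W by move=> x _ i; rewrite inE.
have [W' [W'W W'S rk]] := restrict_support W setT (fiedler_zero_set M fk) WT.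
apply: leq_trans rk _; rewrite leq_add2r.
apply: (rank_negsemidef_tree_like W' (setT :\: fiedler_zero_set M fk)) => //.
- by apply/subsetP=> i; rewrite !inE andbT => /negPf ->.
- by rewrite disjoints_subset setTD.
- by move=> x xW'; apply: Wneg; apply: submx_trans W'W.
Qed.

(** * Counting edges and components of the positive-edge graph *)

Lemma nedges_support :
  nedges V (adj M) = (nedges setT (pos_edge M fk) + #|neg_edges|)%N.
Proof.
rewrite /nedges -cardsUI [X in (_ + X)%N](_ : _ = 0)%N ?addn0; last first.
  by apply: eq_card0 => p; rewrite !inE; case: (pos_edge M fk _ _); rewrite ?andbF.
apply: eq_card => p; rewrite !inE /=.
have := pos_edge_coef p.1 p.2.
case: (pos_edge M fk p.1 p.2); last by rewrite !andbF !andbT.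
case: (adj M p.1 p.2) => //= /esym neg.
have [f1|_] := eqVneq (f p.1 0) 0; first by rewrite f1 mulr0 mul0r ltxx in neg.
have [f2|_] := eqVneq (f p.2 0) 0; first by rewrite f2 mulr0 ltxx in neg.
by rewrite !andbT !andbF orbF.
Qed.

(** A zero of [f] lies on no positive edge, so it forms a component by itself. *)
Lemma ncomp_setT_pos_edge :
  ncomp setT (pos_edge M fk) = (strong_nodal_domains M fk + #|~: V|)%N.
Proof.
have restrictE : restrict setT (pos_edge M fk) =2 restrict V (pos_edge M fk).
  move=> x y; rewrite /restrict !inE /= pos_edge_coef.
  have [fx|_] := eqVneq (f x 0) 0; first by rewrite fx mulr0 mul0r ltxx andbF.
  by have [fy|//] := eqVneq (f y 0) 0; rewrite fy mulr0 ltxx andbF.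
have connV x y : x != y -> connect (restrict V (pos_edge M fk)) x y -> (x \in V) && (y \in V).
  move=> xy cxy; have sc := sym_connect_sym (restrict_sym (S := V) pos_edge_sym).
  have fst u v : u != v -> connect (restrict V (pos_edge M fk)) u v -> u \in V.
    move=> uv /connectP[[|w p] /=]; first by move=> _ vu; rewrite vu eqxx in uv.
    by case/andP=> /and3P[].
  by rewrite (fst x y) // (fst y x) 1?eq_sym // sc.
rewrite /strong_nodal_domains.
have compV x : x \in V ->
    component setT (pos_edge M fk) x = component V (pos_edge M fk) x.
  move=> xV; apply/setP => y; rewrite !in_set /= (eq_connect restrictE).
  have [<-|xy] := eqVneq x y; first by move: xV; rewrite in_set => ->.
  have [c|] := boolP (connect _ x y); last by rewrite andbF.
  by have /andP[_] := connV _ _ xy c; rewrite in_set => ->.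
have compZ x : x \notin V -> component setT (pos_edge M fk) x = [set x].
  move=> xV; apply/setP => y; rewrite in_set1 !in_set /= (eq_connect restrictE) eq_sym.
  have [<-|xy] := eqVneq x y; first by rewrite connect0.
  by apply: contraNF xV => /connV-/(_ xy)/andP[].
have -> : #|~: V| = #|(@set1 'I_n) @: (~: V)| by rewrite card_imset //; exact: set1_inj.
have nE S e : ncomp S e = #|component S e @: S| by [].
rewrite !nE -cardsUI [X in (_ + X)%N](_ : _ = 0)%N ?addn0; last first.
  apply: eq_card0 => C; rewrite in_setI; apply/negP => /andP[/imsetP[x xV ->]].
  case/imsetP=> z zV /setP/(_ x); rewrite in_set1 in_set xV connect0 => /esym/eqP xz.
  by move: zV; rewrite -xz in_setC xV.
have -> : component setT (pos_edge M fk) @: setT =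
    component setT (pos_edge M fk) @: (V :|: ~: V) by rewrite setUCr.
rewrite imsetU (eq_in_imset compV).
suff -> : component setT (pos_edge M fk) @: (~: V) = (@set1 'I_n) @: (~: V) by [].
by apply: eq_in_imset => x; rewrite in_setC; exact: compZ.
Qed.

End Nodal.

(** * From sorted eigenvalues to the nodal count *)

Lemma count_le_sorted {R : realDomainType} (s : seq R) (m : nat) l :
  (m <= size s)%N -> (forall i, (i < m)%N -> nth 0 s i <= l) ->
  (m <= count (<= l) s)%N.
Proof.
move=> ms sl; rewrite -{1}(cat_take_drop m s) count_cat.
suff -> : count (<= l) (take m s) = m by exact: leq_addr.
rewrite -[RHS](size_takel ms); apply/eqP; rewrite -all_count.
apply/(all_nthP 0) => i; rewrite size_takel // => im.
by rewrite nth_take //=; exact: sl.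
Qed.

Theorem theorem6p2 (R : realType) (n : nat) (M : 'M[R]_n) (s : seq R)
    (k r : nat) (f : 'cV[R]_n) :
  M^T = M ->
  size s = n ->
  sorted <=%R s ->
  char_poly M = \prod_(x <- s) ('X - x%:P) ->
  (1 <= k)%N -> (1 <= r)%N -> (k + r - 1 <= n)%N ->
  ((1 < k)%N -> lam s (k - 1) < lam s k) ->
  (forall i : nat, (k <= i <= k + r - 1)%N -> lam s i = lam s k) ->
  ((k + r <= n)%N -> lam s (k + r - 1) < lam s (k + r)) ->
  f != 0 ->
  M *m f = lam s k *: f ->
  let fk := fun x : 'I_n => f x 0 in
  ((strong_nodal_domains M fk)%:Z >=
     (k + r - 1)%:Z - ell' M fk + ell_plus M fk
     - (#|fiedler_zero_set M fk|)%:Z)%R.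
Proof.
move=> symM sz srt chM k1 r1 krn _ lamk _ _ eigf; cbv zeta.
have [W [rkW Wneg]] := sym_negsemidef_rank M s (lam s k) symM chM.
have krW : (k + r - 1 <= \rank W)%N.
  apply: leq_trans rkW; apply: count_le_sorted; rewrite ?sz // => i ikr.
  (* Comparing with the last copy of the eigenvalue brings all of the first [k + r - 1] entries
     below it; [lam] counts from one and [nth] from zero. *)
  rewrite -(lamk (k + r - 1)%N); last by apply/andP; split; lia.
  have sEi : (i < size s)%N by rewrite sz (leq_trans ikr).
  have sEk : ((k + r - 1).-1 < size s)%N by rewrite sz; clear -krn k1 r1; lia.
  rewrite /lam; apply: (sorted_leq_nth le_trans le_refl 0 srt) => //.
  by clear -ikr; lia.
have := rank_negsemidef M (lam s k) f symM eigf W Wneg.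
have := nedges_support M f.
have := ncomp_setT_pos_edge M f symM.
have := cardsC (Defs.support (fun x => f x 0)); rewrite card_ord.
(* With the counts above, [ell_plus - ell'] becomes the number of nodal domains minus negative edges
   minus components of the support, and the rank bound finishes by linear arithmetic. *)
rewrite /ell' /ell_plus /cyclo cardsT card_ord.
move: (ncomp setT _) (nedges setT _) (nedges _ (adj M)) (ncomp _ (adj M)) => c1 e1 e2 c2.
move: #|neg_edges M f| #|fiedler_zero_set M _| #|Defs.support _| #|~: _| => a1 a2 a3 a4.
move: (strong_nodal_domains _ _) (\rank W) krW => d w krW.
clear -krW k1 r1; lia.
Qed.
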